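(* Let $\Gamma<\operatorname{SL}_2(\mathbb{R})$ be a cofinite Fuchsian group with the standing normalization below. For every $\gamma\in\Gamma$ with $|\operatorname{tr}(\gamma)|\ge2$, $$\Psi(\gamma)=\lim_{n\to\infty}\frac{\Phi(\gamma^n)}{n}.$$
   Context: A cofinite Fuchsian group is a discrete $\Gamma<\operatorname{SL}_2(\mathbb{R})$ with $\Gamma\backslash\mathbb{H}$ noncompact of finite area $V$; normalized so that $\infty$ is a cusp with stabilizer generated by $\begin{pmatrix}1&1\\0&1\end{pmatrix}$ (and $-I$ if $-I\in\Gamma$). $j(g,z)=cz+d$; principal branch of $\log$. $f(z)=iz+\sum_{n\ge1}c(n)e^{2\pi inz}$ is the holomorphic function attached to the cusp $\infty$ (Burrin's construction from Kronecker's first limit formula), real coefficients, such that $\Phi(\gamma)=\frac1i(f(\gamma z)-f(z)-V^{-1}\operatorname{sign}(c)^2\log(-j(\gamma,z)^2))$ is real and independent of $z$ for $\gamma=\begin{pmatrix}a&b\\c&d\end{pmatrix}\in\Gamma$; it satisfies $\Phi(\gamma_1\gamma_2)-\Phi(\gamma_1)-\Phi(\gamma_2)=-\pi V^{-1}\operatorname{sign}(c_1c_2c_3)$, where $c_1,c_2,c_3$ are the lower-left entries of $\gamma_1,\gamma_2,\gamma_1\gamma_2$. The Rademacher symbol is $\Psi(\gamma)=\Phi(\gamma)-\pi V^{-1}\operatorname{sign}(c(a+d))$, $\operatorname{sign}(0)=0$. *)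

(* Defs.v *)
From HB Require Import structures.
From mathcomp Require Import all_boot all_order all_algebra.
From mathcomp Require Import all_classical all_reals all_analysis.
From mathcomp.real_closed Require Import complex.

Set Implicit Arguments.
Unset Strict Implicit.
Unset Printing Implicit Defensive.

Import Order.TTheory GRing.Theory Num.Theory.
Import numFieldNormedType.Exports.
Local Open Scope classical_set_scope.
Local Open Scope ring_scope.
Local Open Scope complex_scope.

(* [Num.Theory] shadows these two projections of R[i]. *)
Local Notation Re := complex.Re.
Local Notation Im := complex.Im.
Local Notation cmod := ComplexField.Normc.normc.

Definition upper_half {R : realType} : set R[i] := [set z | 0 < Im z].

(* With z = x + iy: exp z = e^x (cos y + i sin y). *)
Definition cexp {R : realType} (z : R[i]) : R[i] :=
  (expR (Re z) * cos (Im z)) +i* (expR (Re z) * sin (Im z)).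

(* Principal argument, in ]-pi, pi]. *)
Definition carg {R : realType} (z : R[i]) : R :=
  if 0 <= Im z then acos (Re z / cmod z) else - acos (Re z / cmod z).

Definition clog {R : realType} (z : R[i]) : R[i] := ln (cmod z) +i* carg z.

Definition autj {R : realType} (g : 'M[R]_2) (z : R[i]) : R[i] :=
  (g 1 0)%:C * z + (g 1 1)%:C.

Definition mobius {R : realType} (g : 'M[R]_2) (z : R[i]) : R[i] :=
  ((g 0 0)%:C * z + (g 0 1)%:C) / autj g z.

Definition is_subgroup_SL2 {R : realType} (G : set 'M[R]_2) : Prop :=
  [/\ forall g, G g -> \det g = 1,
      G 1%:M,
      forall g h, G g -> G h -> G (g *m h)
    & forall g, G g -> G (invmx g)].

(* A set with exactly one point in each G-orbit on the upper half-plane,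
   Borel when the plane is viewed as R * R. *)
Definition fundamental_set {R : realType} (G : set 'M[R]_2) (F : set R[i]) : Prop :=
  [/\ measurable [set p : R * R | F (p.1 +i* p.2)],
      F `<=` upper_half
    & forall z, upper_half z ->
        exists! w, F w /\ exists2 g, G g & w = mobius g z].

(* The integral of dx dy / y^2 over F. *)
Definition hyperbolic_area {R : realType} (F : set R[i]) : \bar R :=
  (\int[lebesgue_measure \x lebesgue_measure]_(p in
     [set p : R * R | F (p.1 +i* p.2)]) ((p.2 ^- 2)%:E))%E.

(* Open sets of the quotient G\H correspond to the G-invariant open subsets of
   H, so this is the open-cover compactness of the quotient. *)
Definition compact_quotient {R : realType} (G : set 'M[R]_2) : Prop :=
  forall (I : choiceType) (D : set I) (U : I -> set R[i]),
    (forall i, D i ->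
       [/\ open [set p : R * R | U i (p.1 +i* p.2)],
           U i `<=` upper_half
         & forall g z, G g -> U i z -> U i (mobius g z)]) ->
    upper_half `<=` cover D U ->
    finite_subset_cover D U upper_half.

(* A discrete subgroup of SL_2(R) with noncompact quotient of finite area V. *)
Definition cofinite_fuchsian {R : realType} (G : set 'M[R]_2) (V : R) : Prop :=
  [/\ is_subgroup_SL2 G,
      G `<=` isolated G,
      ~ compact_quotient G
    & exists2 F, fundamental_set G F & hyperbolic_area F = V%:E].

Definition translation {R : realType} (n : int) : 'M[R]_2 :=
  \matrix_(i, j) (if (i == 0) && (j == 1) then n%:~R else (i == j)%:R).

(* g fixes infinity iff its lower-left entry vanishes. *)
Definition stab_infty {R : realType} (G : set 'M[R]_2) : set 'M[R]_2 :=
  [set g | G g /\ g 1 0 = 0].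

(* The stabilizer of infinity is generated by the translation by 1, together
   with -I when -I lies in G. *)
Definition normalized_cusp {R : realType} (G : set 'M[R]_2) : Prop :=
  forall g, stab_infty G g <->
    exists n : int, g = translation n \/ (G (- 1%:M) /\ g = - translation n).

Definition infty_cosets {R : realType} (G : set 'M[R]_2) : set (set 'M[R]_2) :=
  [set C | exists2 g, G g & C = [set h *m g | h in stab_infty G]].

(* E(z, s), the sum of Im(g z)^s over the cosets of G modulo the stabilizer of
   infinity. For a normalized cusp the term does not depend on the
   representative g; [xget 1%:M C] picks one in C. *)
Definition eisenstein {R : realType} (G : set 'M[R]_2) (z : R[i]) (s : R) : \bar R :=
  (\esum_(C in infty_cosets G) ((Im (mobius (xget 1%:M C) z) `^ s)%:E))%E.

Definition Phi_at {R : realType} (f : R[i] -> R[i]) (V : R) (g : 'M[R]_2)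
    (z : R[i]) : R[i] :=
  'i%C^-1 * (f (mobius g z) - f z
           - (V^-1 * Num.sg (g 1 0) ^+ 2)%:C * clog (- autj g z ^+ 2)).

(* [attached_to_infty] makes [Phi_at] real and independent of z on H; the
   base point i is then immaterial. *)
Definition Phi {R : realType} (f : R[i] -> R[i]) (V : R) (g : 'M[R]_2) : R :=
  Re (Phi_at f V g 'i%C).

Definition Psi {R : realType} (f : R[i] -> R[i]) (V : R) (g : 'M[R]_2) : R :=
  Phi f V g - pi / V * Num.sg (g 1 0 * (g 0 0 + g 1 1)).

(* f(z) = iz + sum_(n >= 1) c(n) exp(2 pi i n z), with c(n) real. *)
Definition has_expansion {R : realType} (f : R[i] -> R[i]) (c : nat -> R) : Prop :=
  forall z, upper_half z ->
    (fun N => \sum_(1 <= n < N.+1) (c n)%:C * cexp ((2 * pi * n%:R) *i * z)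
        : R[i]^o) @ \oo --> (f z - 'i%C * z : R[i]^o).

(* Kronecker's first limit formula at the cusp infinity:
     lim_(s -> 1+) (E(z, s) - 1 / (V (s - 1)))
       = C - Re f(z) - V^-1 log (Im z).
   It determines Re f up to an additive constant on H, hence f itself, as the
   Fourier expansion of f has no constant term. *)
Definition kronecker_limit {R : realType} (G : set 'M[R]_2) (V : R)
    (f : R[i] -> R[i]) : Prop :=
  exists C : R, forall z, upper_half z ->
    fine (eisenstein G z s) - (V * (s - 1))^-1 @[s --> 1^'+]
      --> C - Re (f z) - V^-1 * ln (Im z).

Definition attached_to_infty {R : realType} (G : set 'M[R]_2) (V : R)
    (f : R[i] -> R[i]) : Prop :=
  [/\ forall z, upper_half z -> derivable (f : R[i]^o -> R[i]^o) z 1,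
      exists c : nat -> R, has_expansion f c,
      kronecker_limit G V f
    & forall g z, G g -> upper_half z -> Phi_at f V g z = (Phi f V g)%:C].

(* Main.v *)
(* The f-terms telescope, so Phi is additive up to the defect of
   sign(c)^2 arg (- j(g, z)^2) on a product.  When c != 0, - j^2 is the square
   of w = - i sign(c) j, which has positive real part, so arg (- j^2) = 2 arg w
   without wrap-around and the defect of Phi is - pi / V * sign (c1 c2 c3).  If
   |tr g| >= 2, the lower-left entry of g^n is c times a Chebyshev value; for
   n >= 1 these do not vanish and consecutive ones multiply to the sign of tr g.
   Hence Phi (g^(n+1)) = Phi g + n Psi g exactly. *)
Require Import Defs.
From HB Require Import structures.
From mathcomp Require Import all_boot all_order all_algebra.
From mathcomp Require Import all_classical all_reals all_analysis.
From mathcomp.real_closed Require Import complex.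
From mathcomp Require Import ring lra.

Set Implicit Arguments.
Unset Strict Implicit.
Unset Printing Implicit Defensive.

Import Order.TTheory GRing.Theory Num.Theory.
Import numFieldNormedType.Exports.
Local Open Scope classical_set_scope.
Local Open Scope ring_scope.

Local Notation Re := complex.Re.
Local Notation Im := complex.Im.

(** * Polar form and the principal argument *)

Definition polar {R : realType} (r t : R) : R[i] :=
  Complex (r * cos t) (r * sin t).

Lemma polarM (R : realType) (r s t u : R) :
  polar r t * polar s u = polar (r * s) (t + u).
Proof.
by rewrite /polar; apply/eqP; rewrite eq_complex /= cosD sinD; apply/andP; split;
  apply/eqP; ring.
Qed.

(** [acos] recovers the absolute value of [t], and the sign of [sin t] selects the branch of
    [carg]. *)
Lemma carg_polar (R : realType) (r t : R) :
  0 < r -> - pi < t -> t < pi -> carg (polar r t) = t.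
Proof.
move=> r0 lt gt.
have nE : ComplexField.Normc.normc (polar r t) = r.
  rewrite /polar /= !exprMn -mulrDr cos2Dsin2 mulr1 sqrtr_sqr.
  by rewrite gtr0_norm.
rewrite /carg nE /polar /= mulrAC divff ?gt_eqF// mul1r.
have [t0|t0] := leP 0 t.
  rewrite mulr_ge0 ?sin_ge0_pi ?t0 ?ltW//.
  by rewrite cosK// in_itv/= t0 ltW.
have : 0 < sin (- t) by apply: sin_gt0_pi; apply/andP; split; lra.
rewrite sinN oppr_gt0 => s0; rewrite leNgt pmulr_rlt0// s0 /= -cosN cosK ?opprK//.
by rewrite in_itv/=; apply/andP; split; lra.
Qed.

Lemma polar_ex (R : realType) (w : R[i]) : 0 < Re w ->
  exists r t, [/\ 0 < r, - (pi / 2) < t, t < pi / 2 & w = polar r t].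
Proof.
case: w => x y /= x0.
have c0 : 0 < cos (atan (y / x)).
  by rewrite cos_gt0_pihalf// atan_gtNpi2 atan_ltpi2.
exists (x / cos (atan (y / x))), (atan (y / x)); split.
- exact: divr_gt0.
- exact: atan_gtNpi2.
- exact: atan_ltpi2.
rewrite /polar divfK ?gt_eqF//; congr Complex.
by rewrite -mulrA [_^-1 * _]mulrC -/(tan _) atanK mulrC divfK ?gt_eqF//.
Qed.

(** A shift by pi shows that the cosine is nonpositive on both outer stretches of the interval; this
    is what excludes wrap-around. *)
Lemma lt_pihalf_of_cos_gt0 (R : realType) (t : R) :
  - (pi / 2) - pi < t -> t < pi / 2 + pi -> 0 < cos t ->
  - (pi / 2) < t /\ t < pi / 2.
Proof.
move=> lt gt c0; split; rewrite ltNge; apply/negP => le_t.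
  have : 0 <= cos (- (t + pi)).
    by rewrite cosN; apply: cos_ge0_pihalf; apply/andP; split; lra.
  by rewrite cosN cosDpi; lra.
have : 0 <= cos (t - pi) by apply: cos_ge0_pihalf; apply/andP; split; lra.
by rewrite -(opprK (cos (t - pi))) -cosDpi subrK; lra.
Qed.

Lemma carg_oppsqr_mul (R : realType) (j1 j2 : R[i]) :
  Im j1 != 0 -> Im j2 != 0 -> Im (j1 * j2) != 0 ->
  carg (- (j1 * j2) ^+ 2) - carg (- j1 ^+ 2) - carg (- j2 ^+ 2)
    = pi * Num.sg (Im j1 * Im j2 * Im (j1 * j2)).
Proof.
(* Since W (j1 * j2) = i s W j1 W j2, its argument is t1 + t2 + s pi / 2; no
   multiple of 2 pi intervenes because its real part is positive. *)
pose W (j : R[i]) := (Complex 0 (- Num.sg (Im j)) : R[i]) * j.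
have WE j : Im j != 0 -> 0 < Re (W j) /\ W j ^+ 2 = - j ^+ 2.
  move=> j0; split; first by rewrite /W; case: j j0 => x y /= y0;
    rewrite mul0r sub0r mulNr opprK -normrEsg normr_gt0.
  rewrite /W exprMn -[RHS]mulN1r; congr (_ * _).
  apply/eqP; rewrite eq_complex expr2 /=.
  by rewrite !mul0r mulr0 addr0 oppr0 eqxx andbT sub0r mulrNN -expr2 sqr_sg j0.
move=> h1 h2 h3.
have [p1 q1] := WE _ h1; have [p2 q2] := WE _ h2; have [p3 q3] := WE _ h3.
have [r1 [t1 [r10 l1 g1 E1]]] := polar_ex p1.
have [r2 [t2 [r20 l2 g2 E2]]] := polar_ex p2.
rewrite -q1 -q2 -q3 E1 E2 !expr2 !polarM.
(* The doubled angles stay in ]-pi, pi[ because [t1] and [t2] lie in ]-pi/2, pi/2[. *)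
rewrite !carg_polar ?mulr_gt0//; try lra.
set s := Num.sg (_ * _ * _).
have s1 : s = 1 \/ s = -1.
  rewrite /s; case: sgrP; [|by left|by right].
  by move/eqP; rewrite !mulf_eq0 !(negPf h1, negPf h2, negPf h3).
have sg1 : Num.sg (Im j1) ^+ 2 = 1 by rewrite sqr_sg h1.
have sg2 : Num.sg (Im j2) ^+ 2 = 1 by rewrite sqr_sg h2.
have W3 : W (j1 * j2) = polar (r1 * r2) (t1 + t2 + s * (pi / 2)).
  have -> : t1 + t2 + s * (pi / 2) = s * (pi / 2) + (t1 + t2) by rewrite addrC.
  rewrite -[r1 * r2]mul1r -polarM -(polarM r1) -E1 -E2.
  have -> : polar 1 (s * (pi / 2)) = Complex 0 s.
    by rewrite /polar; case: s1 => ->;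
      rewrite ?mulN1r ?mul1r ?cosN ?sinN ?cos_pihalf ?sin_pihalf.
  rewrite /W mulrACA [RHS]mulrA; congr (_ * _).
  rewrite /s !sgrM; move: sg1 sg2.
  (* What remains is - i z = (i x y z) (- i x) (- i y), which holds since x^2 = y^2 = 1. *)
  move: (Num.sg (Im j1)) (Num.sg (Im j2)) (Num.sg (Im (j1 * j2))) => x y z x1 y1.
  apply/eqP; rewrite eq_complex /= !mul0r !mulr0 ?subr0 ?addr0 ?oppr0 ?add0r ?sub0r.
  apply/andP; split; first by rewrite mulr0 oppr0.
  apply/eqP; rewrite mulrNN mulrN; congr (- _).
  by rewrite mulrAC mulrACA -!expr2 -exprMn exprMn x1 y1 !mul1r.
have [l3 g3] : - (pi / 2) < t1 + t2 + s * (pi / 2) /\ t1 + t2 + s * (pi / 2) < pi / 2.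
  apply: lt_pihalf_of_cos_gt0.
  - by case: s1 => ->; lra.
  - by case: s1 => ->; lra.
  - by move: p3; rewrite W3 /= pmulr_rgt0 // mulr_gt0.
rewrite W3 polarM carg_polar ?mulr_gt0//; lra.
Qed.

(** * Two-by-two matrices acting on the upper half-plane *)

Lemma mulmx2E (R : pzRingType) (g h : 'M[R]_2) i j :
  (g *m h) i j = g i 0 * h 0 j + g i 1 * h 1 j.
Proof.
rewrite mxE !big_ord_recl big_ord0 addr0.
by have -> : lift ord0 ord0 = 1 :> 'I_2 by exact: val_inj.
Qed.

Lemma det_mx2E (R : comPzRingType) (g : 'M[R]_2) :
  \det g = g 0 0 * g 1 1 - g 0 1 * g 1 0.
Proof.
rewrite (expand_det_row _ 0) !big_ord_recl big_ord0 /cofactor !det_mx11 !mxE /=.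
rewrite expr0 expr1 mul1r mulN1r mulrN addr0.
by congr (g _ _ * g _ _ - g _ _ * g _ _); exact: val_inj.
Qed.

Lemma mxtrace_mx2E (R : pzSemiRingType) (g : 'M[R]_2) : \tr g = g 0 0 + g 1 1.
Proof.
by rewrite /mxtrace !big_ord_recl big_ord0 addr0; congr (_ + g _ _); exact: val_inj.
Qed.

Lemma Im_autj (R : realType) (g : 'M[R]_2) (z : R[i]) :
  Im (autj g z) = g 1 0 * Im z.
Proof. by case: z => x y; rewrite /autj /= mul0r !addr0. Qed.

(** A zero would force c = 0 through its imaginary part, then d = 0, against determinant 1. *)
Lemma autj_neq0 (R : realType) (g : 'M[R]_2) (z : R[i]) :
  \det g = 1 -> upper_half z -> autj g z != 0.
Proof.
move=> dg z0; apply/eqP => j0.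
have c0 : g 1 0 = 0.
  move: (Im_autj g z); rewrite j0 /= => /esym/eqP.
  by rewrite mulf_eq0 [Im z == 0]gt_eqF// orbF => /eqP.
have d0 : g 1 1 = 0.
  by move: j0; rewrite /autj c0 mul0r add0r => -[].
by move: dg; rewrite det_mx2E c0 d0 !mulr0 subr0 => /eqP; rewrite eq_sym oner_eq0.
Qed.

Lemma upper_half_mobius (R : realType) (g : 'M[R]_2) (z : R[i]) :
  \det g = 1 -> upper_half z -> upper_half (mobius g z).
Proof.
move=> dg z0; have := autj_neq0 dg z0.
case: z z0 => x y; change (0 < y -> autj g (Complex x y) != 0 ->
  0 < Im (mobius g (Complex x y))) => y0 j0.
rewrite eq_complex /= !mul0r !addr0 subr0 in j0.
have n0 : 0 < (g 1 0 * x + g 1 1) ^+ 2 + (g 1 0 * y) ^+ 2.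
  by rewrite lt0r addr_ge0 ?sqr_ge0// paddr_eq0 ?sqr_ge0// !sqrf_eq0 j0.
suff -> : Im (mobius g (Complex x y)) =
    (\det g * y) / ((g 1 0 * x + g 1 1) ^+ 2 + (g 1 0 * y) ^+ 2).
  by rewrite dg mul1r divr_gt0.
rewrite det_mx2E /mobius /autj /= !mul0r !addr0 !subr0.
by field; rewrite gt_eqF.
Qed.

(** The cocycle relation: the denominator of [mobius h z] is [autj h z], nonzero here, and
    cancels. *)
Lemma autjM (R : realType) (g h : 'M[R]_2) (z : R[i]) :
  \det h = 1 -> upper_half z ->
  autj (g *m h) z = autj g (mobius h z) * autj h z.
Proof.
move=> dh z0; have j0 := autj_neq0 dh z0.
rewrite {2}/autj mulrDl /mobius -mulrA divfK// /autj.
rewrite !mulmx2E !rmorphD !rmorphM /=; ring.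
Qed.

Lemma mobiusM (R : realType) (g h : 'M[R]_2) (z : R[i]) :
  \det g = 1 -> \det h = 1 -> upper_half z ->
  mobius (g *m h) z = mobius g (mobius h z).
Proof.
move=> dg dh z0; have j0 := autj_neq0 dh z0.
have j1 := autj_neq0 dg (upper_half_mobius dh z0).
rewrite {1 2}/mobius autjM// invfM mulrA mulrAC; congr (_ / _).
rewrite /mobius; apply: (mulIf j0); rewrite divfK// mulrDl mulrA divfK//.
rewrite /autj !mulmx2E !rmorphD !rmorphM /=; ring.
Qed.

(** * The defect of [Phi] on products *)

(** Division by i turns imaginary parts into real parts, so only the argument in [clog] survives. *)
Lemma Re_Phi_at (R : realType) (f : R[i] -> R[i]) (V : R) (g : 'M[R]_2) (z : R[i]) :
  Re (Phi_at f V g z) = Im (f (mobius g z)) - Im (f z)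
    - V^-1 * (Num.sg (g 1 0) ^+ 2 * carg (- autj g z ^+ 2)).
Proof.
rewrite /Phi_at /clog.
move: (ln _) (carg _) (f _) (f _) => x y [a b] [a' b'] /=.
rewrite expr0n expr1n /= add0r !mul0r divr1; ring.
Qed.

(** Evaluating the symbol of [g] at h(i) and that of [h] at i cancels f(h(i)). The three lower-left
    entries vanish together or not at all, so the factors sign(c)^2 agree. *)
Lemma Phi_mul (R : realType) (f : R[i] -> R[i]) (V : R) (g h : 'M[R]_2) :
  \det g = 1 -> \det h = 1 ->
  (forall z, upper_half z -> Phi_at f V g z = (Phi f V g)%:C%C) ->
  (h 1 0 == 0) = (g 1 0 == 0) -> ((g *m h) 1 0 == 0) = (g 1 0 == 0) ->
  Phi f V (g *m h) = Phi f V g + Phi f V h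
    - pi / V * Num.sg (g 1 0 * h 1 0 * (g *m h) 1 0).
Proof.
move=> dg dh Phi_const h0 gh0.
have i_uh : upper_half ('i%C : R[i]) by exact: ltr01.
have hi_uh := upper_half_mobius dh i_uh.
have -> : Phi f V g = Re (Phi_at f V g (mobius h 'i%C)) by rewrite Phi_const.
rewrite /Phi !Re_Phi_at mobiusM//.
suff : Num.sg ((g *m h) 1 0) ^+ 2 * carg (- autj (g *m h) 'i%C ^+ 2)
     - Num.sg (g 1 0) ^+ 2 * carg (- autj g (mobius h 'i%C) ^+ 2)
     - Num.sg (h 1 0) ^+ 2 * carg (- autj h 'i%C ^+ 2)
     = pi * Num.sg (g 1 0 * h 1 0 * (g *m h) 1 0).
  by rewrite [pi / V * _]mulrAC => <-; ring.
rewrite !sqr_sg h0 gh0; have [->|g0] /= := eqVneq (g 1 0) 0.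
  by rewrite !mul0r sgr0 mulr0 !subr0.
(* As Im j = c Im z with Im z > 0, the signs of the imaginary parts are those of the lower-left
   entries. *)
rewrite !mul1r autjM// carg_oppsqr_mul -?autjM// !Im_autj.
- by rewrite !sgrM (gtr0_sg i_uh) (gtr0_sg hi_uh) !mulr1.
- by rewrite mulf_neq0// gt_eqF.
- by rewrite mulf_neq0 ?h0// gt_eqF.
- by rewrite mulf_neq0 ?gh0// gt_eqF.
Qed.

(** * Chebyshev values and powers of a matrix *)

(** For n >= 1 this is U_(n-1)(t / 2), with U the Chebyshev polynomials of the second kind. *)
Fixpoint chebU {R : realType} (t : R) (n : nat) : R :=
  match n with
  | 0 => 0
  | 1 => 1
  | (m.+1 as k).+1 => t * chebU t k - chebU t m
  end.

(** Cayley-Hamilton, g^2 = (tr g) g - 1, gives the powers of [g] the recurrence of [chebU]. *)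
Lemma expr_mx2_10 (R : realType) (g : 'M[R]_2) (n : nat) :
  \det g = 1 -> (g ^+ n) 1 0 = g 1 0 * chebU (\tr g) n.
Proof.
move=> dg.
have H : forall n, (g ^+ n) 1 0 = g 1 0 * chebU (\tr g) n /\
               (g ^+ n.+1) 1 0 = g 1 0 * chebU (\tr g) n.+1.
  elim=> [|m [IH0 IH1]].
    by rewrite expr0 expr1 mxE /= mulr0 mulr1.
  split=> //.
  have -> : (g ^+ m.+2) 1 0 = \tr g * (g ^+ m.+1) 1 0 - (g ^+ m) 1 0.
    rewrite !exprS -!mulmxE !mulmx2E mxtrace_mx2E -[X in _ - X]mul1r -dg det_mx2E; ring.
  by rewrite IH0 IH1 /=; ring.
by have [] := H n.
Qed.

(** The twisted values satisfy b_(n+2) = |t| b_(n+1) - b_n. With |t| >= 2 they never decrease from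
    b_0 = 1; the induction carries positivity and monotonicity together. *)
Lemma chebU_gt0 (R : realType) (t : R) (n : nat) :
  2 <= `|t| -> 0 < Num.sg t ^+ n * chebU t n.+1.
Proof.
move=> t2; have e2 : Num.sg t ^+ 2 = 1.
  by rewrite sqr_sg -normr_gt0 (lt_le_trans _ t2).
suff [] : 0 < Num.sg t ^+ n * chebU t n.+1 /\
  Num.sg t ^+ n * chebU t n.+1 <= Num.sg t ^+ n.+1 * chebU t n.+2 by [].
elim: n => [|n [IH0 IH1]].
  by rewrite expr0 expr1 /= !mulr1 subr0 -normrEsg; split=> //; lra.
split; first exact: lt_le_trans IH1.
set a := Num.sg t ^+ n * _ in IH0 IH1.
set b := Num.sg t ^+ n.+1 * _ in IH1 *.
have -> : Num.sg t ^+ n.+2 * chebU t n.+3 = `|t| * b - a.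
  rewrite /a /b normrEsg -[chebU t n.+3]/(t * chebU t n.+2 - chebU t n.+1).
  rewrite !exprS mulrA -expr2 e2 mul1r; ring: e2.
have : 2 * b <= `|t| * b by rewrite ler_wpM2r//; lra.
lra.
Qed.

Lemma sg_chebU_mul (R : realType) (t : R) (n : nat) :
  2 <= `|t| -> Num.sg (chebU t n.+1 * chebU t n.+2) = Num.sg t.
Proof.
move=> t2; have /gtr0_sg := mulr_gt0 (chebU_gt0 n t2) (chebU_gt0 n.+1 t2).
have e2 : Num.sg t ^+ 2 = 1.
  by rewrite sqr_sg -normr_gt0 (lt_le_trans _ t2).
rewrite mulrACA sgrM exprS mulrCA -expr2 exprAC e2 expr1n mulr1 sgr_id => E.
by rewrite -[LHS]mul1r -e2 expr2 -mulrA E mulr1.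
Qed.

(** * Powers of [g] and the limit *)

(** Each further factor [g] adds exactly [Psi f V g]. The induction starts at the first power, since
    the zeroth has lower-left entry 0. *)
Lemma Phi_expr (R : realType) (G : set 'M[R]_2) (V : R) (f : R[i] -> R[i])
    (g : 'M[R]_2) (n : nat) :
  is_subgroup_SL2 G ->
  (forall h z, G h -> upper_half z -> Phi_at f V h z = (Phi f V h)%:C%C) ->
  G g -> 2 <= `|\tr g| ->
  Phi f V (g ^+ n.+1) = Phi f V g + n%:R * Psi f V g.
Proof.
move=> [Gdet G1 GM _] Phi_const Gg t2; have dg := Gdet g Gg.
have GX k : G (g ^+ k) by elim: k => [|k IH]; rewrite ?expr0// exprS; exact: GM.
have U0 k : chebU (\tr g) k.+1 != 0.
  by have := chebU_gt0 k t2; apply: contraTneq => ->; rewrite mulr0 ltxx.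
elim: n => [|n IH]; first by rewrite expr1 mul0r addr0.
rewrite exprS -mulmxE Phi_mul ?(Gdet (g ^+ n.+1))//; first last.
- by rewrite mulmxE -exprS expr_mx2_10// mulf_eq0 (negPf (U0 _)) orbF.
- by rewrite expr_mx2_10// mulf_eq0 (negPf (U0 _)) orbF.
- by move=> z; exact: Phi_const.
rewrite mulmxE -exprS IH !expr_mx2_10// /Psi -mxtrace_mx2E.
have -> : Num.sg (g 1 0 * (g 1 0 * chebU (\tr g) n.+1) * (g 1 0 * chebU (\tr g) n.+2))
   = Num.sg (g 1 0 * \tr g).
  (* The entry c occurs three times, and sign(c)^3 = sign(c). *)
  rewrite -!mulrA !sgrM.
  rewrite -(sg_chebU_mul n t2) !sgrM; case: (sgrP (g 1 0)) => _; ring.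
by rewrite -natr1; ring.
Qed.

Theorem theorem5p4 (R : realType) (G : set 'M[R]_2) (V : R) (f : R[i] -> R[i])
    (hG : cofinite_fuchsian G V) (hcusp : normalized_cusp G)
    (hf : attached_to_infty G V f) (g : 'M[R]_2) (hg : G g)
    (htr : 2 <= `|\tr g|) :
  (fun n : nat => Phi f V (g ^+ n) / n%:R) @ \oo --> Psi f V g.
Proof.
have [sG _ _ _] := hG; have [_ _ _ Phi_const] := hf.
rewrite -(cvg_shiftS _).
have -> : (fun n => Phi f V (g ^+ n.+1) / n.+1%:R) =
    (fun n => Psi f V g + (Phi f V g - Psi f V g) * n.+1%:R^-1).
  by apply/funext => n; rewrite (Phi_expr _ sG Phi_const)//; field.
set L := Psi f V g.
suff : (fun n => L + (Phi f V g - L) * n.+1%:R^-1) @ \oo --> L + (Phi f V g - L) * 0.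
  by rewrite mulr0 addr0.
apply: cvgD; first exact: cvg_cst.
by apply: cvgMr; exact: cvg_harmonic.
Qed.
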